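(* For every prime number $p$, $$p-\theta(p) = (\log p)\,\bigl(Li^*(p)-\pi(p)\bigr)+1-\sum_{x=2}^{p-1}\log\Bigl(\frac{x+1}{x}\Bigr)\bigl(Li^*(x)-\pi(x)\bigr),$$ where the sum runs over integers $x$ with $2\le x\le p-1$ (and is empty for $p=2$).
   Context: Here $\log$ is the natural logarithm, $\pi(x)$ is the number of primes $\le x$, and $\theta(x)=\sum_{r\le x,\ r\text{ prime}}\log r$ is the first Chebyshev function. For an integer $n\ge 2$, $Li^*(n)=\sum_{x=2}^{n}\frac{1}{\log x}$, the sum running over integers $x$ (a discrete sum used in place of the logarithmic integral). *)

(* Defs.v *)
From mathcomp Require Import all_boot all_order all_algebra.
From mathcomp Require Import reals exp.

Set Implicit Arguments.
Unset Strict Implicit.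
Unset Printing Implicit Defensive.

Import Order.TTheory GRing.Theory Num.Theory.
Local Open Scope ring_scope.

(* The three functions below are only ever evaluated at natural numbers, so
   their argument is a nat. *)

Definition prime_pi (x : nat) : nat := count prime (iota 0 x.+1).

Definition chebyshev_theta (R : realType) (x : nat) : R :=
  \sum_(0 <= r < x.+1 | prime r) ln (r%:R : R).

Definition Li_star (R : realType) (n : nat) : R :=
  \sum_(2 <= x < n.+1) (ln (x%:R : R))^-1.

(* Main.v *)
(** Abel summation of [a x * ln x] for [a x = 1 / ln x - [x is prime]]: the
    partial sums of [a] are [Li* - pi], and each [x] with [2 <= x <= p]
    contributes [1 - [x is prime] ln x] to the left-hand side, so that the sum
    is [p - 1 - theta(p)]. *)
Require Import Defs.
From mathcomp Require Import all_boot all_order all_algebra.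
From mathcomp Require Import reals exp.
From mathcomp Require Import ring.

Import Order.TTheory GRing.Theory Num.Theory.
Local Open Scope ring_scope.

(** Induction on [n - m]: when [n] grows by one, the new difference term turns [f n] into [f n.+1]
    in front of the old partial sum, which leaves [f n.+1 * a n.+1]. *)
Lemma abel_summation (R : comPzRingType) (a f : nat -> R) (m n : nat) :
  (m <= n)%N ->
  \sum_(m <= x < n.+1) f x * a x =
    f n * (\sum_(m <= k < n.+1) a k)
    - \sum_(m <= x < n) (f x.+1 - f x) * (\sum_(m <= k < x.+1) a k).
Proof.
move=> /subnK <-; elim: (n - m)%N => [|d IHd].
  by rewrite add0n !big_nat1 big_geq // subr0.
rewrite addSn big_nat_recr ?leqW ?leq_addl //= IHd.
rewrite [\sum_(m <= k < (d + m).+2) a k]big_nat_recr ?leqW ?leq_addl //=.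
rewrite [\sum_(m <= x < (d + m).+1) (_ * _)]big_nat_recr ?leq_addl //=.
ring.
Qed.

(** Since 0 and 1 are not prime, the count can start at 2, the lower bound in [Li_star]. *)
Lemma prime_pi_sum (n : nat) :
  (2 <= n)%N -> prime_pi n = (\sum_(2 <= x < n.+1) prime x)%N.
Proof.
move=> n2; rewrite /prime_pi -sum1_count big_mkcond.
rewrite -[iota 0 n.+1]/(index_iota 0 n.+1).
by rewrite big_ltn // big_ltn ?ltnS ?(ltnW n2).
Qed.

Lemma chebyshev_theta_sum (R : realType) (n : nat) :
  (2 <= n)%N ->
  chebyshev_theta R n = \sum_(2 <= x < n.+1) ln (x%:R : R) * (prime x)%:R.
Proof.
move=> n2; rewrite /chebyshev_theta big_mkcond.
rewrite big_ltn // big_ltn ?ltnS ?(ltnW n2) //= !add0r.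
by apply: eq_bigr => x _; case: prime; rewrite ?mulr1 ?mulr0.
Qed.

Lemma Li_star_sub_prime_pi (R : realType) (n : nat) :
  (2 <= n)%N ->
  Li_star R n - (prime_pi n)%:R =
    \sum_(2 <= x < n.+1) ((ln (x%:R : R))^-1 - (prime x)%:R).
Proof. by move=> n2; rewrite prime_pi_sum // natr_sum sumrB. Qed.

Theorem mainTheorem1 (R : realType) (p : nat) (hp : prime p) :
  p%:R - chebyshev_theta R p =
    ln (p%:R : R) * (Li_star R p - (prime_pi p)%:R) + 1
    - \sum_(2 <= x < p)
        ln ((x.+1)%:R / x%:R : R) * (Li_star R x - (prime_pi x)%:R).
Proof.
have p2 := prime_gt1 hp.
pose a (x : nat) : R := (ln (x%:R : R))^-1 - (prime x)%:R.
have sum_a : \sum_(2 <= x < p.+1) ln (x%:R : R) * a x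
    = p%:R - 1 - chebyshev_theta R p.
  have -> : p%:R - 1 = \sum_(2 <= x < p.+1) (1 : R).
    by rewrite sumr_const_nat subSS natrB // ltnW.
  rewrite chebyshev_theta_sum // -sumrB.
  (* The inverse in [a x] cancels because [x >= 2] makes [ln x] positive. *)
  apply: eq_big_nat => x /andP[x2 _]; rewrite mulrBr mulfV //.
  by rewrite gt_eqF // ln_gt0 // ltr1n.
(* The weight [ln ((x + 1) / x)] is the increment of [ln] from [x] to [x + 1]. *)
have -> : \sum_(2 <= x < p)
      ln ((x.+1)%:R / x%:R : R) * (Li_star R x - (prime_pi x)%:R)
    = \sum_(2 <= x < p) (ln (x.+1%:R : R) - ln (x%:R : R))
        * \sum_(2 <= k < x.+1) a k.
  apply: eq_big_nat => x /andP[x2 _].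
  by rewrite Li_star_sub_prime_pi // ln_div ?posrE ?ltr0n // ltnW.
(* With the 1 moved to the end, the rest is the right-hand side of [abel_summation] for [f = ln]. *)
rewrite Li_star_sub_prime_pi // addrAC.
rewrite -(@abel_summation _ a (fun x => ln (x%:R : R))) // sum_a.
ring.
Qed.
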